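(* Let $\Gamma$, the new edge $\mathcal{E}$ and the spine $\mathcal{S}=\Gamma+\mathcal{E}$ be as specified in the context, and suppose the endpoints of $\mathcal{E}$ lie in two different connected components of $\Gamma$ (edge attachment). (1) If $\mathcal{E}$ connects two distinct stacked components, then $$\mathrm{MeanDiam}(\mathcal{S})=\frac{(\mathrm{ord}(\ell)+3)(h(-p)+\mathrm{ord}(\ell))}{2(h(-p)-\mathrm{ord}(\ell))}.$$ (2) If $\mathcal{E}$ connects the folded component to a stacked component, then $$\frac{h(-p)\,\mathrm{ord}(\ell)+3h(-p)+6\,\mathrm{ord}(\ell)}{2(h(-p)-\mathrm{ord}(\ell))}\ \le\ \mathrm{MeanDiam}(\mathcal{S})\ \le\ \frac{(\mathrm{ord}(\ell)+3)(h(-p)+\mathrm{ord}(\ell))}{2(h(-p)-\mathrm{ord}(\ell))}.$$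
   Context: Let $p$ be a prime with $p\equiv 71$ or $119\pmod{120}$ and $\ell=2$. Let $h(-p)$ be the class number of $\mathbb{Q}(\sqrt{-p})$ (it is odd) and let $L=\mathrm{ord}(\ell)$ be the order in the class group of a prime ideal above $2$; $L$ is an odd integer $\ge3$ dividing $h(-p)$. The graph $\Gamma$ (the supersingular $2$-isogeny graph over $\mathbb{F}_p$ after identifying curves and isogenies up to $\overline{\mathbb{F}_p}$-equivalence, regarded as a simple undirected graph) is the disjoint union of one folded component $\mathcal{F}$ and $\frac12\left(\frac{h(-p)}{L}-1\right)$ stacked components, each a copy of $\mathcal{T}$, where $V(\mathcal{F})=\{0,\dots,L-1\}$, $E(\mathcal{F})=\{\{2k-1,2k+1\}: 1\le k\le \tfrac12(L-3)\}\cup\{\{2k+1,2k+2\}:0\le k\le \tfrac12(L-3)\}\cup\{\{0,1\}\}$, and $V(\mathcal{T})=\{0,\dots,2L-1\}$, $E(\mathcal{T})=\{\{2i,2i+1\}:0\le i\le L-1\}\cup\{\{2i+1,2i+3\}:0\le i\le L-2\}\cup\{\{2L-1,1\}\}$. Floor vertices are the nonzero even vertices of $\mathcal{F}$ and all even vertices of the stacked components. The spine $\mathcal{S}$ is obtained from $\Gamma$ by adding a single new edge $\mathcal{E}$ (coming from $2$-isogenies not defined over $\mathbb{F}_p$), whose endpoints are two distinct floor vertices; it is treated here as an arbitrary such edge. For a graph with connected components $C_1,\dots,C_m$, $\mathrm{MeanDiam}$ is $\frac1m\sum_{i=1}^m\mathrm{diam}(C_i)$. *)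

(* Defs.v *)
From HB Require Import structures.
From mathcomp Require Import all_boot all_order all_algebra all_field.

Set Implicit Arguments.
Unset Strict Implicit.
Unset Printing Implicit Defensive.

Import Order.TTheory GRing.Theory Num.Theory.
Local Open Scope ring_scope.

Definition quad_field (p : nat) (x : algC) : Prop :=
  exists a b : rat, x = ratr a + ratr b * sqrtC (- p%:R).

Definition ring_of_integers (p : nat) (x : algC) : Prop :=
  quad_field p x /\ x \in Aint.

(* Subsets of algC are Prop-valued predicates, compared extensionally. *)
Record is_ideal (O I : algC -> Prop) : Prop := IsIdeal {
  ideal_sub : forall x, I x -> O x;
  ideal_zero : I 0;
  ideal_add : forall x y, I x -> I y -> I (x + y);
  ideal_mul : forall a x, O a -> I x -> I (a * x)
}.

Definition nonzero_ideal (O I : algC -> Prop) : Prop :=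
  is_ideal O I /\ exists2 x, I x & x != 0.

Definition prime_ideal (O I : algC -> Prop) : Prop :=
  [/\ is_ideal O I, ~ I 1 &
      forall a b, O a -> O b -> I (a * b) -> I a \/ I b].

Definition ideal_prod (I J : algC -> Prop) (x : algC) : Prop :=
  exists2 s : seq (algC * algC),
    (forall u, u \in s -> I u.1 /\ J u.2) & x = \sum_(u <- s) u.1 * u.2.

Fixpoint ideal_exp (O I : algC -> Prop) (k : nat) : algC -> Prop :=
  if k is k'.+1 then ideal_prod I (ideal_exp O I k') else O.

(* a I = b J for some nonzero a, b in O. *)
Definition ideal_equiv (O I J : algC -> Prop) : Prop :=
  exists a b : algC,
    [/\ O a /\ a != 0, O b /\ b != 0 &
        forall x, (exists2 y, I y & x = a * y) <-> (exists2 z, J z & x = b * z)].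

(* h is the number of classes of nonzero ideals of O: there is a complete
   irredundant system of h representatives. *)
Definition is_class_number (O : algC -> Prop) (h : nat) : Prop :=
  exists r : 'I_h -> algC -> Prop,
    [/\ forall i, nonzero_ideal O (r i),
        forall i j, ideal_equiv O (r i) (r j) -> i = j &
        forall I, nonzero_ideal O I -> exists i, ideal_equiv O I (r i)].

Definition is_class_order (O I : algC -> Prop) (L : nat) : Prop :=
  [/\ (0 < L)%N,
      ideal_equiv O (ideal_exp O I L) O &
      forall k, (0 < k < L)%N -> ~ ideal_equiv O (ideal_exp O I k) O].

Section Graph.
Variables (T : finType) (e : rel T).

(* The junk value #|T| is returned when no path joins x to y.  Distances in the
   whole graph agree with distances inside a connected component. *)
Definition dist (x y : T) : nat :=
  find (fun k => [exists t : k.-tuple T, path e x t && (last x t == y)])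
       (iota 0 #|T|).

Definition components : {set {set T}} :=
  equivalence_partition (connect e) [set: T].

Definition diam (C : {set T}) : nat :=
  (\max_(x in C) \max_(y in C) dist x y)%N.

Definition mean_diam : rat :=
  (\sum_(C in components) (diam C)%:R) / #|components|%:R.

Definition add_edge (u v : T) : rel T :=
  [rel x y | [|| e x y, (x == u) && (y == v) | (x == v) && (y == u)]].

End Graph.

Local Open Scope nat_scope.

(* One pair (a, b) per undirected edge {a, b}; for L = 3 the first family is
   empty. *)
Definition folded_edges (L : nat) : seq (nat * nat) :=
  [seq (2 * k - 1, 2 * k + 1) | k <- index_iota 1 ((L - 3)./2).+1] ++
  [seq (2 * k + 1, 2 * k + 2) | k <- index_iota 0 ((L - 3)./2).+1] ++
  [:: (0, 1)].

Definition stacked_edges (L : nat) : seq (nat * nat) :=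
  [seq (2 * i, 2 * i + 1) | i <- index_iota 0 L] ++
  [seq (2 * i + 1, 2 * i + 3) | i <- index_iota 0 (L - 1)] ++
  [:: (2 * L - 1, 1)].

Definition adjacent (E : seq (nat * nat)) (a b : nat) : bool :=
  ((a, b) \in E) || ((b, a) \in E).

Definition num_stacked (h L : nat) : nat := (h %/ L - 1)./2.

(* inl a is the vertex a of the folded component; inr (i, a) is the vertex a of
   the i-th stacked component. *)
Definition vertex (h L : nat) : finType :=
  ('I_L + 'I_(num_stacked h L) * 'I_(2 * L))%type.

Definition Gamma (h L : nat) : rel (vertex h L) := fun x y =>
  match x, y with
  | inl a, inl b => adjacent (folded_edges L) a b
  | inr (i, a), inr (j, b) => (i == j) && adjacent (stacked_edges L) a b
  | _, _ => false
  end.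

Definition in_folded (h L : nat) (x : vertex h L) : bool :=
  if x is inl _ then true else false.

Definition in_stacked (h L : nat) (x : vertex h L) : bool := ~~ in_folded x.

Definition is_floor (h L : nat) (x : vertex h L) : bool :=
  match x with
  | inl a => (val a != 0) && ~~ odd a
  | inr (_, a) => ~~ odd a
  end.

(* Main.v *)
Require Import Defs.
From HB Require Import structures.
From mathcomp Require Import all_boot all_order all_algebra all_field.
From mathcomp Require Import zify ring.

Set Implicit Arguments.
Unset Strict Implicit.
Unset Printing Implicit Defensive.

Import Order.TTheory GRing.Theory Num.Theory.
Local Open Scope ring_scope.

(** Gamma is a path (folded component) or cycles of length L (stacked
    components) in which every spine vertex 2i+1 carries pendant vertices, so
    its distances are explicit: the distance of the spines plus one for each
    endpoint that is pendant.  The new edge joins two components into one whose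
    diameter is ecc(u) + 1 + ecc(v), and leaves the others unchanged.  With
    L = 2k+1, a pendant vertex has eccentricity k+2 in a stacked component, and
    a floor vertex of the folded component has eccentricity between (k+3)/2
    (the middle of the path) and k+1 (its end). *)

(** Restricted to the image of [k], since all other classes share the empty fibre. *)
Lemma fiber_inj (T K : finType) (k : T -> K) :
  {in k @: setT &, injective (fun c => [set x | k x == c])}.
Proof.
move=> c c' /imsetP[x _ ->] _ /setP/(_ x); rewrite !inE eqxx.
by move/esym/eqP.
Qed.

(** * Distances, eccentricities and mean diameter in a finite graph *)

Section Distance.
Local Open Scope nat_scope.
Variables (T : finType) (e : rel T).

Lemma dist_path x y : connect e x y ->
  exists2 t, path e x t & last x t = y /\ size t = dist e x y.
Proof.
case/connectP=> p ep ->; case/shortenP: ep => q eq Uq _.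
(* A duplicate-free path has fewer than [#|T|] edges, so the search in [dist] succeeds and the junk
   value is not returned. *)
have ltq : size q < #|T| by have /card_uniqP := Uq; rewrite /= => <-; apply: max_card.
have hs : has (fun k => [exists t : k.-tuple T,
    path e x t && (last x t == last x q)]) (iota 0 #|T|).
  apply/hasP; exists (size q); first by rewrite mem_iota.
  by apply/existsP; exists (in_tuple q); rewrite eq eqxx.
have := nth_find 0 hs; rewrite nth_iota; last by rewrite -[X in _ < X](size_iota 0) -has_find.
case/existsP=> t /andP[et /eqP lt]; exists (val t) => //; split => //.
by rewrite size_tuple.
Qed.

Lemma dist_le_size x t : path e x t -> dist e x (last x t) <= size t.
Proof.
move=> et; rewrite /dist; set a := (X in find X _).
case: (ltnP (size t) #|T|) => ltT; last first.
  by apply: leq_trans ltT; rewrite -[X in _ <= X](size_iota 0) find_size.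
rewrite leqNgt; apply/negP => /(before_find 0); rewrite nth_iota //.
by move/existsP => []; exists (in_tuple t); rewrite et eqxx.
Qed.

Lemma dist_triangle x y z : connect e x y -> connect e y z ->
  dist e x z <= dist e x y + dist e y z.
Proof.
move=> /dist_path[s es [<- <-]] /dist_path[t et [<- <-]].
by rewrite -last_cat -size_cat; apply: dist_le_size; rewrite cat_path es.
Qed.

Lemma dist_edge x y : e x y -> dist e x y <= 1.
Proof. by move=> exy; apply: (@dist_le_size x [:: y]); rewrite /= exy. Qed.

Lemma dist_lipschitz (f : T -> nat) x y :
  (forall a b, e a b -> f b <= (f a).+1) -> connect e x y ->
  f y <= f x + dist e x y.
Proof.
move=> lip /dist_path[t et [<- <-]] {y}.
elim: t x et => [|y t IH] x /=; first by rewrite addn0.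
case/andP=> exy /IH; have := lip _ _ exy; lia.
Qed.

(** A certificate for distances from [x]: growth by at most one per edge bounds the distance below
    by [f], and descent towards [x] inside [A] yields both a path and the upper bound. *)
Lemma dist_eq_potential (A : pred T) (f : T -> nat) x :
  f x = 0 -> (forall a b, e a b -> f b <= (f a).+1) ->
  (forall b, A b -> b != x -> exists a, [/\ A a, e a b & f a < f b]) ->
  forall b, A b -> connect e x b /\ dist e x b = f b.
Proof.
move=> fx0 lip step b Ab.
suff [cb db] : connect e x b /\ dist e x b <= f b.
  split=> //; apply/eqP; rewrite eqn_leq db.
  by have := dist_lipschitz lip cb; rewrite fx0.
have [m] := ubnP (f b); elim: m => // m IH in b Ab *.
have [-> _|nbx] := eqVneq b x.
  by split; [exact: connect0 | rewrite fx0; exact: (@dist_le_size x [::])].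
have [a [Aa eab lt_ab]] := step b Ab nbx; rewrite ltnS => le_bm.
have [ca da] := IH a Aa (leq_trans lt_ab le_bm).
have cab := connect1 eab; split; first exact: connect_trans cab.
apply: leq_trans (dist_triangle ca cab) _.
by have := dist_edge eab; lia.
Qed.

Lemma dist_sym x y : symmetric e -> connect e x y -> dist e x y = dist e y x.
Proof.
move=> sym_e cxy.
have le_dist a b : connect e a b -> dist e b a <= dist e a b.
  case/dist_path=> t et [lt <-].
  have := @dist_le_size b (rev (belast a t)).
  have -> : last b (rev (belast a t)) = a.
    by case: t lt {et} => //= c t _; rewrite rev_cons last_rcons.
  rewrite size_rev size_belast; apply.
  rewrite -lt rev_path (eq_path (e' := e)) // => c d; exact: sym_e.
by apply/eqP; rewrite eqn_leq !le_dist // (sym_connect_sym sym_e).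
Qed.

(** Only vertices connected to [x] count, which keeps the junk value of [dist] out of the
    maximum. *)
Definition ecc x := \max_(y | connect e x y) dist e x y.

Lemma diam_le (C : {set T}) d :
  (forall x y, x \in C -> y \in C -> dist e x y <= d) -> diam e C <= d.
Proof.
by move=> le_d; apply/bigmax_leqP => x xC; apply/bigmax_leqP => y; apply: le_d.
Qed.

Lemma dist_le_diam (C : {set T}) x y :
  x \in C -> y \in C -> dist e x y <= diam e C.
Proof.
move=> xC yC; rewrite /diam (bigD1 x) //=; apply: leq_trans (leq_maxl _ _).
exact: leq_bigmax_cond.
Qed.

Lemma dist_le_ecc x y : connect e x y -> dist e x y <= ecc x.
Proof. exact: leq_bigmax_cond. Qed.

Lemma ecc_witness x : exists2 y, connect e x y & dist e x y = ecc x.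
Proof.
have cx : 0 < #|connect e x| by apply/card_gt0P; exists x; apply: connect0.
by have [y cy dy] := eq_bigmax_cond (dist e x) cx; exists y; rewrite // -dy.
Qed.

Lemma components_fibers (K : finType) (A : {set K}) (k : T -> K) :
  (forall x y, connect e x y = (k x == k y)) -> k @: setT = A ->
  components e = [set [set x | k x == c] | c in A].
Proof.
move=> ck <-; rewrite /components /equivalence_partition -imset_comp.
apply: eq_imset => x /=; apply/setP => y.
by rewrite !inE /= ck eq_sym.
Qed.

(** Replaces the sum over sets of vertices by a sum over component labels, which is easier to split
    after two components merge. *)
Lemma mean_diam_fibers (K : finType) (A : {set K}) (k : T -> K) :
  (forall x y, connect e x y = (k x == k y)) -> k @: setT = A ->
  mean_diam e =
    ((\sum_(c in A) diam e [set x | k x == c])%N%:R / #|A|%:R)%R.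
Proof.
move=> ck kA; rewrite /mean_diam (components_fibers ck kA) -kA.
have inj := @fiber_inj T K k; rewrite big_imset // (card_in_imset inj).
by rewrite natr_sum.
Qed.

End Distance.

(** * Joining two components by an edge *)

Section AddEdge.
Local Open Scope nat_scope.
Variables (T K : finType) (e : rel T) (k : T -> K) (u v : T).
Hypotheses (sym_e : symmetric e) (ck : forall x y, connect e x y = (k x == k y)).
Hypothesis kuv : k u != k v.
Let S := add_edge e u v.

Lemma add_edge_sym : symmetric S.
Proof.
move=> x y; rewrite /S /add_edge /= sym_e; congr orb.
by rewrite orbC; congr orb; rewrite andbC.
Qed.

Lemma sub_connect_add_edge x y : connect e x y -> connect S x y.
Proof.
move=> cxy; apply: connect_sub cxy => a b eab.
by apply: connect1; rewrite /S /add_edge /= eab.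
Qed.

Lemma add_edge_uv : S u v. Proof. by rewrite /S /add_edge /= !eqxx orbT. Qed.

(** The component of [v] takes over the label of [u], so [k v] is the one label that disappears. *)
Definition merge_class x := if k x == k v then k u else k x.

Lemma connect_add_edge x y : connect S x y = (merge_class x == merge_class y).
Proof.
have csym := sym_connect_sym add_edge_sym.
apply/idP/eqP.
  case/connectP=> t; elim: t x => [|z t IH] x /= => [_ ->//|/andP[exz pt] ly].
  rewrite -(IH z pt ly); case/or3P: exz.
  - by move/connect1; rewrite ck /merge_class => /eqP ->.
  - by case/andP=> /eqP-> /eqP->; rewrite /merge_class eqxx (negPf kuv).
  - by case/andP=> /eqP-> /eqP->; rewrite /merge_class eqxx (negPf kuv).
have toE a b : k a = k b -> connect S a b.
  by move=> ab; apply: sub_connect_add_edge; rewrite ck ab.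
have toV a : connect S a u = connect S a v.
  by apply: same_connect_r => //; apply: connect1; exact: add_edge_uv.
rewrite /merge_class; case: eqP => xv; case: eqP => yv E.
- by apply: toE; rewrite xv.
- by apply: connect_trans (toE u y E); rewrite toV toE.
- by apply: connect_trans (toE x u E) _; rewrite csym toV toE.
- exact: toE.
Qed.

Lemma merge_class_image :
  k @: setT = setT -> merge_class @: setT = [set c | c != k v].
Proof.
move=> kT; apply/setP => c; rewrite !inE; apply/imsetP/idP.
  by case=> x _ ->; rewrite /merge_class; case: ifPn.
move=> cv; have : c \in k @: setT by rewrite kT.
by case/imsetP=> x _ cx; exists x; rewrite // /merge_class -cx (negPf cv).
Qed.

Lemma dist_add_edge_same x y : connect e x y -> dist S x y <= dist e x y.
Proof.
move=> /dist_path[t et [<- <-]]; apply: dist_le_size.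
by apply: sub_path et => a b eab; rewrite /S /add_edge /= eab.
Qed.

Lemma dist_add_edge_other x y :
  k x != k u -> k x != k v -> connect e x y -> dist S x y = dist e x y.
Proof.
move=> xu xv cxy; apply/eqP; rewrite eqn_leq dist_add_edge_same //=.
(* Old distance, extended by 0 outside the component of [x]. The new edge lies outside that
   component, so [f] still grows by at most one per edge. *)
pose f z := if connect e x z then dist e x z else 0.
have lip a b : S a b -> f b <= (f a).+1.
  rewrite /f; case/or3P => [eab|/andP[/eqP-> /eqP->]|/andP[/eqP-> /eqP->]].
  - case: ifP => [cb|//]; have cba : connect e b a by rewrite connect1 // sym_e.
    have ca := connect_trans cb cba; rewrite ca.
    apply: leq_trans (dist_triangle ca (connect1 eab)) _.
    by have := dist_edge eab; lia.
  - by rewrite !ck (negPf xu) (negPf xv).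
  - by rewrite !ck (negPf xu) (negPf xv).
have := dist_lipschitz lip (sub_connect_add_edge cxy).
rewrite /f cxy connect0; suff -> : dist e x x = 0 by [].
by apply/eqP; rewrite -leqn0; apply: (@dist_le_size _ e x [::]).
Qed.

(** The new edge is the only link between the two components, so a shortest path goes to [u],
    crosses once, and continues from [v]. *)
Lemma dist_add_edge_cross x y : k x = k u -> k y = k v ->
  dist S x y = (dist e u x + dist e v y).+1.
Proof.
move=> xu yv.
have cux : connect e u x by rewrite ck xu.
have cxu : connect e x u by rewrite ck xu.
have cvy : connect e v y by rewrite ck yv.
have [Sxu Svy] := (sub_connect_add_edge cxu, sub_connect_add_edge cvy).
have Suv : connect S u v := connect1 add_edge_uv.
have Suy := connect_trans Suv Svy.
apply/eqP; rewrite eqn_leq; apply/andP; split.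
  have := dist_triangle Sxu Suy; have := dist_triangle Suv Svy.
  have := dist_add_edge_same cxu; have := dist_add_edge_same cvy.
  by have := dist_edge add_edge_uv; rewrite (dist_sym sym_e cux); lia.
(* The lower bound comes from a potential that is the old distance on the side of [x] and the
   claimed value on the side of [v]; third components get 0. *)
pose f z := if connect e x z then dist e x z else
  if connect e v z then (dist e x u + dist e v z).+1 else 0.
have xv : k x != k v by rewrite xu.
have e00 z : dist e z z = 0.
  by apply/eqP; rewrite -leqn0; apply: (@dist_le_size _ e z [::]).
have lip a b : S a b -> f b <= (f a).+1.
  rewrite /f; case/or3P => [eab|/andP[/eqP-> /eqP->]|/andP[/eqP-> /eqP->]].
  - have cab := connect1 eab; have dab := dist_edge eab.
    have := cab; rewrite !ck => /eqP ab; rewrite -ab.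
    case: ifPn => [xa|xa]; last case: ifPn => [va|//].
    + by apply: leq_trans (dist_triangle _ cab) _; rewrite ?ck // -addn1 leq_add2l.
    + rewrite ltnS -addnS leq_add2l.
      by apply: leq_trans (dist_triangle _ cab) _; rewrite ?ck // -addn1 leq_add2l.
  - by rewrite connect0 cxu ck (negPf xv) e00 addn0.
  - by rewrite connect0 cxu ck (negPf xv) e00 addn0; lia.
have := dist_lipschitz lip (connect_trans Sxu Suy).
by rewrite /f connect0 e00 ck yv (negPf xv) cvy (dist_sym sym_e cux).
Qed.

Let fiber c := [set x | k x == c].
Let merged c := [set x | merge_class x == c].

Lemma diam_other c : c != k u -> c != k v -> diam S (merged c) = diam e (fiber c).
Proof.
move=> cu cv; have -> : merged c = fiber c.
  apply/setP => x; rewrite !inE /merge_class; case: ifPn => // /eqP->.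
  by rewrite ![_ == c]eq_sym (negPf cu) (negPf cv).
rewrite /diam; apply: eq_bigr => x; rewrite inE => /eqP xc.
apply: eq_bigr => y; rewrite inE => /eqP yc.
by apply: dist_add_edge_other; rewrite ?ck xc // yc.
Qed.

(** The two hypotheses say that pairs on the same side are no farther apart than the longest
    crossing, which is attained by vertices farthest from [u] and from [v]. *)
Lemma diam_merged :
  diam e (fiber (k u)) <= (ecc e u + ecc e v).+1 ->
  diam e (fiber (k v)) <= (ecc e u + ecc e v).+1 ->
  diam S (merged (k u)) = (ecc e u + ecc e v).+1.
Proof.
move=> du dv; apply/eqP; rewrite eqn_leq; apply/andP; split; last first.
  have [x ux <-] := ecc_witness e u; have [y vy <-] := ecc_witness e v.
  move: ux vy; rewrite !ck => /eqP xu /eqP yv.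
  rewrite -dist_add_edge_cross //; apply: dist_le_diam.
    by rewrite inE /merge_class -xu (negPf kuv).
  by rewrite inE /merge_class -yv eqxx.
have mem x : x \in merged (k u) -> k x = k u \/ k x = k v.
  by rewrite inE /merge_class; case: (k x =P k v) => [->|_ /eqP->]; [right|left].
have cross x y : k x = k u -> k y = k v -> dist S x y <= (ecc e u + ecc e v).+1.
  move=> xu yv; rewrite dist_add_edge_cross // ltnS leq_add //.
    by rewrite dist_le_ecc // ck xu.
  by rewrite dist_le_ecc // ck yv.
have same x y w : k x = k w -> k y = k w ->
    diam e (fiber (k w)) <= (ecc e u + ecc e v).+1 ->
    dist S x y <= (ecc e u + ecc e v).+1.
  move=> xw yw; apply: leq_trans.
  apply: (@leq_trans (dist e x y)).
    by apply: dist_add_edge_same; rewrite ck xw yw.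
  by apply: dist_le_diam; rewrite inE ?xw ?yw.
apply: diam_le => x y mx my.
case: (mem x mx) (mem y my) => [xu|xv] [yu|yv].
- exact: same du.
- exact: cross.
- rewrite (dist_sym add_edge_sym); first exact: cross.
  by move: mx my; rewrite connect_add_edge !inE => /eqP-> /eqP->.
- exact: same dv.
Qed.

End AddEdge.

(** * Explicit distances in paths and cycles with pendant vertices *)

Section ExplicitDistances.
Local Open Scope nat_scope.

Lemma mem_folded_edges L a b : odd L -> 3 <= L ->
  ((a, b) \in folded_edges L) =
  [|| [&& odd a, b == a + 2 & b < L], [&& odd a, b == a.+1 & b < L]
    | (a == 0) && (b == 1)].
Proof.
move=> oL L3; rewrite /folded_edges !mem_cat.
apply: (congr2 orb); last apply: (congr2 orb).
- apply/mapP/idP => [[i]|/and3P[oa /eqP-> lt]].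
    by rewrite mem_index_iota => Hi [-> ->]; lia.
  by exists a./2.+1; rewrite ?mem_index_iota; [lia|congr pair; lia].
- apply/mapP/idP => [[i]|/and3P[oa /eqP-> lt]].
    by rewrite mem_index_iota => Hi [-> ->]; lia.
  by exists a./2; rewrite ?mem_index_iota; [lia|congr pair; lia].
by rewrite inE xpair_eqE.
Qed.

Lemma mem_stacked_edges L a b :
  ((a, b) \in stacked_edges L) =
  [|| [&& ~~ odd a, b == a.+1 & b < 2 * L], [&& odd a, b == a + 2 & b < 2 * L]
    | (a == 2 * L - 1) && (b == 1)].
Proof.
rewrite /stacked_edges !mem_cat.
apply: (congr2 orb); last apply: (congr2 orb).
- apply/mapP/idP => [[i]|/and3P[oa /eqP-> lt]].
    by rewrite mem_index_iota => Hi [-> ->]; lia.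
  by exists a./2; rewrite ?mem_index_iota; [lia|congr pair; lia].
- apply/mapP/idP => [[i]|/and3P[oa /eqP-> lt]].
    by rewrite mem_index_iota => Hi [-> ->]; lia.
  by exists a./2; rewrite ?mem_index_iota; [lia|congr pair; lia].
by rewrite inE xpair_eqE.
Qed.

Section Hairy.
Variables (N M : nat) (sp : nat -> nat) (nx : rel nat) (d : nat -> nat -> nat).
Hypotheses (d_refl : forall i, d i i = 0).
Hypotheses (d_lip : forall i j k, i < M -> j < M -> k < M ->
  nx j k -> d i k <= (d i j).+1).
Hypotheses (d_step : forall i j, i < M -> j < M -> i != j ->
  exists k, [/\ k < M, nx k j & d i k < d i j]).
Hypotheses (spM : forall a, a < N -> sp a < M).
Hypotheses (sp_odd : forall i, i < M -> i.*2.+1 < N /\ sp i.*2.+1 = i).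
Hypotheses (odd_sp : forall a, odd a -> a = (sp a).*2.+1).

(* The vertex 2i+1 is the spine vertex i; an even vertex a is pendant, attached
   to the spine vertex [sp a]. *)
Definition hairy a b :=
  (sp a == sp b) && (odd a != odd b) || [&& odd a, odd b & nx (sp a) (sp b)].

(** The case [a == b] must be separate: the sum gives 2 for two pendants at one spine vertex, which
    is right only if they are distinct, such as 0 and 2 in the folded component. *)
Definition hairy_dist a b :=
  if a == b then 0 else d (sp a) (sp b) + ~~ odd a + ~~ odd b.

Lemma hairy_dist_lipschitz x a b : x < N -> a < N -> b < N ->
  hairy a b -> hairy_dist x b <= (hairy_dist x a).+1.
Proof.
move=> /spM xM /spM aM /spM bM; rewrite /hairy /hairy_dist.
have [//|xb] := eqVneq x b; have [xa|xa] := eqVneq x a.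
  rewrite -{}xa in aM *; case/orP=> [/andP[/eqP->]|/and3P[-> -> /d_lip-/(_ (sp x))]].
    by rewrite d_refl; case: (odd x); case: (odd b).
  by rewrite d_refl !addn0 => /(_ xM xM bM).
case/orP=> [/andP[/eqP-> _]|/and3P[-> -> /d_lip-/(_ (sp x))]].
  by case: (odd a) (odd b) => [] []; rewrite ?addn0 ?addn1 // ltnW.
by move=> /(_ xM aM bM); rewrite !addn0 -addSn leq_add2r.
Qed.

(** A pendant [b] is reached from its spine vertex. If [b] is on the spine, it is reached from [x]
    itself when [x] is a pendant there, and otherwise from the spine neighbour given by [d_step]. *)
Lemma hairy_dist_step x b : x < N -> b < N -> b != x ->
  exists a, [/\ a < N, hairy a b & hairy_dist x a < hairy_dist x b].
Proof.
move=> xN bN bx; have [xM bM] := (spM xN, spM bN).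
rewrite /hairy /hairy_dist [x == b]eq_sym (negPf bx).
have [ob|eb] := boolP (odd b); last first.
  exists (sp b).*2.+1; have [lt ->] := sp_odd bM; rewrite eqxx /= odd_double.
  by split=> //; case: ifP; rewrite ?addn0 addn1.
have [sx|/d_step-/(_ xM bM)[k [kM kb lt]]] := eqVneq (sp x) (sp b).
  have ex : ~~ odd x by apply: contraNN bx => /odd_sp->; rewrite sx -odd_sp.
  by exists x; rewrite sx !eqxx (negPf ex) d_refl.
exists k.*2.+1; have [ltN ->] := sp_odd kM; rewrite /= odd_double kb orbT.
by split=> //; case: ifP => _; lia.
Qed.

End Hairy.

Definition path_next i j := (j == i.+1) || (i == j.+1).

(** The absolute difference: at least one of the truncated subtractions is 0. *)
Definition path_dist (i j : nat) := (i - j) + (j - i).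

Definition cycle_next L i j :=
  [|| path_next i j, (i == 0) && (j == L.-1) | (j == 0) && (i == L.-1)].

Definition cycle_dist L i j := minn (path_dist i j) (L - path_dist i j).

Lemma path_dist_lipschitz i j k :
  path_next j k -> path_dist i k <= (path_dist i j).+1.
Proof. rewrite /path_next /path_dist; lia. Qed.

Lemma path_dist_step M i j : i < M -> j < M -> i != j ->
  exists k, [/\ k < M, path_next k j & path_dist i k < path_dist i j].
Proof.
rewrite /path_next /path_dist neq_ltn => iM jM /orP[lt|gt].
  by exists j.-1; split; lia.
by exists j.+1; split; lia.
Qed.

Lemma cycle_dist_lipschitz L i j k : i < L -> j < L -> k < L ->
  cycle_next L j k -> cycle_dist L i k <= (cycle_dist L i j).+1.
Proof. rewrite /cycle_next /path_next /cycle_dist /path_dist; lia. Qed.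

(** The chosen neighbour of [j] lies on a shorter arc to [i]; when that arc passes the ends of the
    numbering, the step may wrap between [L.-1] and 0. *)
Lemma cycle_dist_step L i j : i < L -> j < L -> i != j ->
  exists k, [/\ k < L, cycle_next L k j & cycle_dist L i k < cycle_dist L i j].
Proof.
rewrite /cycle_next /path_next /cycle_dist /path_dist neq_ltn => iL jL.
case/orP=> lt.
  have [le|gt] := leqP (2 * (j - i)) L.
    by exists j.-1; split; lia.
  by exists (if j == L.-1 then 0 else j.+1); case: ifP => ?; split; lia.
have [le|gt] := leqP (2 * (i - j)) L.
  by exists j.+1; split; lia.
by exists (if j == 0 then L.-1 else j.-1); case: ifP => ?; split; lia.
Qed.

(** In the folded component a pendant follows its spine vertex, whence the predecessor; since [0.-1]
    is 0, the extra pendant 0 falls on the first spine vertex, 1. *)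
Definition folded_spine a := a.-1./2.

Lemma adjacent_folded L a b : odd L -> 3 <= L -> a < L -> b < L ->
  adjacent (folded_edges L) a b = hairy folded_spine path_next a b.
Proof.
move=> oL L3 aL bL.
rewrite /adjacent !mem_folded_edges // /hairy /path_next /folded_spine.
(* Splitting each vertex into parity and half leaves linear conditions on the halves. *)
move: aL bL; rewrite -[a]odd_double_half -[b]odd_double_half.
case: (odd a); case: (odd b); move: a./2 b./2 => {a b} a b;
  rewrite ?add0n ?add1n ?oddS ?odd_double /= ?doubleK; lia.
Qed.

Lemma adjacent_stacked L a b : 3 <= L -> a < 2 * L -> b < 2 * L ->
  adjacent (stacked_edges L) a b = hairy half (cycle_next L) a b.
Proof.
move=> L3 aL bL.
rewrite /adjacent !mem_stacked_edges /hairy /cycle_next /path_next.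
move: aL bL; rewrite -[a]odd_double_half -[b]odd_double_half.
case: (odd a); case: (odd b); move: a./2 b./2 => {a b} a b;
  rewrite ?add0n ?add1n ?oddS ?odd_double /= ?uphalf_double ?doubleK; lia.
Qed.

Definition folded_dist := hairy_dist folded_spine path_dist.
Definition stacked_dist L := hairy_dist half (cycle_dist L).

Lemma folded_dist_lipschitz L x a b : odd L -> 3 <= L ->
  x < L -> a < L -> b < L ->
  adjacent (folded_edges L) a b -> folded_dist x b <= (folded_dist x a).+1.
Proof.
move=> oL L3 xL aL bL; rewrite adjacent_folded //.
apply: (@hairy_dist_lipschitz L L) => // [i|i j k *|c].
- by rewrite /path_dist subnn.
- exact: path_dist_lipschitz.
- rewrite /folded_spine; lia.
Qed.

Lemma folded_dist_step L x b : odd L -> 3 <= L -> x < L -> b < L -> b != x ->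
  exists a, [/\ a < L, adjacent (folded_edges L) a b
              & folded_dist x a < folded_dist x b].
Proof.
move=> oL L3 xL bL bx.
have [|i j|c|i|c|//|//|//|a [aL ab lt]] :=
  (* The sharp spine length [L./2] matters: each index [i] must give a vertex [i.*2.+1] below
     [L]. *)
  @hairy_dist_step L L./2 folded_spine path_next path_dist _ _ _ _ _ x b.
- by move=> i; rewrite /path_dist subnn.
- exact: path_dist_step.
- rewrite /folded_spine; lia.
- by rewrite /folded_spine; split; lia.
- rewrite /folded_spine; lia.
by exists a; rewrite adjacent_folded.
Qed.

Lemma stacked_dist_lipschitz L x a b : 3 <= L ->
  x < 2 * L -> a < 2 * L -> b < 2 * L -> adjacent (stacked_edges L) a b ->
  stacked_dist L x b <= (stacked_dist L x a).+1.
Proof.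
move=> L3 xL aL bL; rewrite adjacent_stacked //.
apply: (@hairy_dist_lipschitz (2 * L) L) => // [i|*|c].
- by rewrite /cycle_dist /path_dist subnn min0n.
- exact: cycle_dist_lipschitz.
- lia.
Qed.

Lemma stacked_dist_step L x b : 3 <= L ->
  x < 2 * L -> b < 2 * L -> b != x ->
  exists a, [/\ a < 2 * L, adjacent (stacked_edges L) a b
              & stacked_dist L x a < stacked_dist L x b].
Proof.
move=> L3 xL bL bx.
have [|i j|c|i|c|//|//|//|a [aL ab lt]] :=
  @hairy_dist_step (2 * L) L half (cycle_next L) (cycle_dist L) _ _ _ _ _ x b.
- by move=> i; rewrite /cycle_dist /path_dist subnn min0n.
- exact: cycle_dist_step.
- lia.
- by split; lia.
- lia.
by exists a; rewrite adjacent_stacked.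
Qed.

(** The spine is a path on [L./2] vertices, of diameter [L./2 - 1], and two pendant endpoints add
    2. *)
Lemma folded_dist_le L a b : odd L -> 3 <= L -> a < L -> b < L ->
  folded_dist a b <= (L./2).+1.
Proof.
move=> oL L3 aL bL.
have : folded_spine a < L./2 by rewrite /folded_spine; lia.
have : folded_spine b < L./2 by rewrite /folded_spine; lia.
rewrite /folded_dist /hairy_dist /path_dist; case: ifP => // _.
by case: (odd a); case: (odd b); lia.
Qed.

Lemma stacked_dist_le L a b : odd L -> a < 2 * L -> b < 2 * L ->
  stacked_dist L a b <= (L./2).+2.
Proof.
move=> oL aL bL; rewrite /stacked_dist /hairy_dist; case: ifP => // _.
have : cycle_dist L a./2 b./2 <= L./2 by rewrite /cycle_dist /path_dist; lia.
by case: (odd a); case: (odd b); lia.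
Qed.

Lemma stacked_dist_far L a : odd L -> 3 <= L -> a < 2 * L -> ~~ odd a ->
  exists2 b, b < 2 * L & stacked_dist L a b = (L./2).+2.
Proof.
move=> oL L3 aL ea; rewrite /stacked_dist /hairy_dist /cycle_dist /path_dist ea.
have [lt|ge] := ltnP a./2 L./2.
  (* The witness is a pendant half a turn away: its spine index is shifted by [L./2], in the
     direction that stays in range. *)
  by exists (a + (L./2).*2); [lia|case: ifP; lia].
by exists (a - (L./2).*2); [lia|case: ifP; lia].
Qed.

Lemma folded_dist_far L a : odd L -> 3 <= L -> a < L -> a != 0 -> ~~ odd a ->
  exists2 b, b < L & L./2 + 3 <= 2 * folded_dist a b.
Proof.
move=> oL L3 aL a0 ea.
rewrite /folded_dist /hairy_dist /path_dist /folded_spine ea.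
have [lt|ge] := leqP a L./2.
  (* The witness is the pendant at the far end of the path. The inequality is tight near the middle,
     and doubling it avoids rounding. *)
  by exists L.-1; [lia|case: ifP; lia].
by exists 0; [lia|case: ifP; lia].
Qed.

Lemma folded_dist_ends L : odd L -> 3 <= L -> folded_dist 0 L.-1 = (L./2).+1.
Proof.
move=> oL L3; rewrite /folded_dist /hairy_dist /path_dist /folded_spine.
by case: ifP; lia.
Qed.

End ExplicitDistances.

(** * Components, eccentricities and diameters of [Gamma] *)

Section Volcano.
Local Open Scope nat_scope.
Variables (h L : nat).
Hypotheses (L_odd : odd L) (L_ge3 : 3 <= L).
Notation n := (num_stacked h L).
Notation G := (@Gamma h L).

Definition component (x : vertex h L) : option 'I_n :=
  if x is inr (i, _) then Some i else None.

(** The value 0 between components keeps growth along edges at most one, since no edge of [Gamma]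
    leaves a component. *)
Definition Gamma_dist (x y : vertex h L) : nat :=
  match x, y with
  | inl a, inl b => folded_dist a b
  | inr (i, a), inr (j, b) => if i == j then stacked_dist L a b else 0
  | _, _ => 0
  end.

Lemma Gamma_sym : symmetric G.
Proof.
have adj_sym E a b : adjacent E a b = adjacent E b a by rewrite /adjacent orbC.
by case=> [a|[i a]] [b|[j b]] //=; rewrite adj_sym // eq_sym.
Qed.

Lemma Gamma_component x y : G x y -> component x = component y.
Proof. by case: x y => [a|[i a]] [b|[j b]] //= /andP[/eqP->]. Qed.

Lemma Gamma_dist_component x y : component x = component y ->
  connect G x y /\ dist G x y = Gamma_dist x y.
Proof.
move=> cxy; pose A z := component x == component z.
apply: (@dist_eq_potential _ _ A) => [|a b|b|]; last exact/eqP.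
- by case: x {cxy A} => [a|[i a]] /=; rewrite ?eqxx /folded_dist /stacked_dist
    /hairy_dist eqxx.
- case: x {cxy A} => [x|[i x]]; case: a => [a|[j a]]; case: b => [b|[k b]] //=.
    by apply: (@folded_dist_lipschitz L).
  case/andP=> /eqP-> adj; case: ifP => // _.
  by apply: stacked_dist_lipschitz.
rewrite {}/A; case: x {cxy} => [x|[i x]]; case: b => [b|[j b]] //= cb bx.
  have [|a [aL ab lt]] := folded_dist_step L_odd L_ge3 (ltn_ord x) (ltn_ord b).
    by apply: contraNneq bx => /val_inj->.
  by exists (inl (Ordinal aL)).
move: cb bx => /eqP[<-] bx.
have [|a [aL ab lt]] := stacked_dist_step L_ge3 (ltn_ord x) (ltn_ord b).
  by apply: contraNneq bx => /val_inj->.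
by exists (inr (i, Ordinal aL)); split; rewrite /= ?eqxx.
Qed.

Lemma connect_Gamma x y : connect G x y = (component x == component y).
Proof.
apply/idP/eqP => [|/Gamma_dist_component[] //].
case/connectP=> t; elim: t x => [|z t IH] x /= => [_ ->//|].
by case/andP=> /Gamma_component-> /IH{}IH /IH.
Qed.

Lemma dist_Gamma x y : component x = component y ->
  dist G x y = Gamma_dist x y.
Proof. by case/Gamma_dist_component. Qed.

Lemma component_image : component @: setT = setT.
Proof.
apply/setP => c; rewrite inE; apply/imsetP.
have L2 : 0 < 2 * L by rewrite muln_gt0 /= (leq_trans _ L_ge3).
case: c => [i|]; first by exists (inr (i, Ordinal L2)).
by exists (inl (Ordinal (leq_trans (isT : 0 < 3) L_ge3))).
Qed.

Definition component_diam (c : option 'I_n) : nat :=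
  L./2 + (if c is Some _ then 2 else 1).

Lemma component_diam_stacked x :
  in_stacked x -> component_diam (component x) = L./2 + 2.
Proof. by case: x => [//|[i a]]. Qed.

Lemma component_diam_folded x :
  in_folded x -> component_diam (component x) = L./2 + 1.
Proof. by case: x => [a|//]. Qed.

Lemma stacked_num_gt0 (x : vertex h L) : in_stacked x -> 0 < n.
Proof. by case: x => [//|[i a]] _; apply: leq_ltn_trans (ltn_ord i). Qed.

Lemma Gamma_dist_le x y : component x = component y ->
  Gamma_dist x y <= component_diam (component x).
Proof.
rewrite /component_diam.
case: x y => [x|[i x]] [y|[j y]] //=; first by rewrite addn1 folded_dist_le.
by case=> ->; rewrite eqxx addn2 stacked_dist_le.
Qed.

Lemma ecc_Gamma_le x : ecc G x <= component_diam (component x).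
Proof.
apply/bigmax_leqP => y; rewrite connect_Gamma => /eqP cxy.
by rewrite dist_Gamma // Gamma_dist_le.
Qed.

Lemma ecc_stacked_floor x : in_stacked x -> is_floor x -> ecc G x = L./2 + 2.
Proof.
case: x => [//|[i a]] _ fl; apply/eqP; rewrite eqn_leq ecc_Gamma_le /=.
have [b bL ab] := stacked_dist_far L_odd L_ge3 (ltn_ord a) fl.
have <- : dist G (inr (i, a)) (inr (i, Ordinal bL)) = L./2 + 2.
  by rewrite dist_Gamma //= eqxx ab addn2.
by apply: dist_le_ecc; rewrite connect_Gamma.
Qed.

Lemma ecc_folded_floor x : in_folded x -> is_floor x ->
  L./2 + 3 <= 2 * ecc G x <= 2 * (L./2 + 1).
Proof.
case: x => [a|//] _ /andP[a0 fl]; rewrite leq_pmul2l // ecc_Gamma_le andbT.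
have [b bL ab] := folded_dist_far L_odd L_ge3 (ltn_ord a) a0 fl.
apply: leq_trans ab _; rewrite leq_pmul2l //.
have <- : dist G (inl a) (inl (Ordinal bL)) = folded_dist a b.
  by rewrite dist_Gamma.
by apply: dist_le_ecc; rewrite connect_Gamma.
Qed.

Lemma diam_Gamma c : diam G [set x | component x == c] = component_diam c.
Proof.
apply/eqP; rewrite eqn_leq; apply/andP; split.
  apply: diam_le => x y; rewrite !inE => /eqP <- /eqP yx.
  by rewrite dist_Gamma // Gamma_dist_le.
have L0 : 0 < L by apply: leq_trans L_ge3.
have L2 : 0 < 2 * L by rewrite muln_gt0.
have pL : L.-1 < L by rewrite prednK.
case: c => [i|].
  (* Vertex 0 of a stacked component is a floor vertex, so its eccentricity already attains the
     diameter. *)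
  rewrite /component_diam -(@ecc_stacked_floor (inr (i, Ordinal L2))) //.
  have [y] := ecc_witness G (inr (i, Ordinal L2)).
  rewrite connect_Gamma => /eqP cy <-; apply: dist_le_diam; rewrite inE //.
  by rewrite -cy.
rewrite /component_diam addn1 -folded_dist_ends //.
have <- : dist G (inl (Ordinal L0)) (inl (Ordinal pL)) = folded_dist 0 L.-1.
  by rewrite dist_Gamma.
by apply: dist_le_diam; rewrite inE.
Qed.

(** There are [n] stacked components and one folded component, whose diameter is smaller by 1. *)
Lemma sum_component_diam :
  \sum_c component_diam c = n.+1 * (L./2 + 2) - 1.
Proof.
rewrite (bigD1 None) //= (eq_bigr (fun=> L./2 + 2)); last by case.
rewrite sum_nat_const cardC1 card_option card_ord /component_diam mulSn /=; lia.
Qed.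

(** The merged diameter replaces the two old ones and [n] components remain. The 1 contributed by
    the new edge cancels the 1 by which the folded diameter falls short. *)
Lemma mean_diam_attachment u v (S := add_edge G u v) :
  is_floor u -> is_floor v -> component u != component v ->
  in_stacked u \/ in_stacked v ->
  (mean_diam S = (n.+1 * (L./2 + 2)
     + (ecc G u + ecc G v)
     - (component_diam (component u) + component_diam (component v)))%N%:R
     / n%:R)%R.
Proof.
move=> fu fv cuv stk.
have connS := connect_add_edge Gamma_sym connect_Gamma cuv.
have imS := merge_class_image cuv component_image.
rewrite (mean_diam_fibers connS imS); congr ((_%:R / _%:R)%R); last first.
  by rewrite cardsE cardC1 card_option card_ord.
have merged : diam S [set x | merge_class component u v x == component u]
    = (ecc G u + ecc G v).+1.
  have big x : component_diam (component x) <= L./2 + 2.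
    by rewrite /component_diam; case: component; rewrite // leq_add2l.
  (* A stacked floor endpoint alone has eccentricity equal to the largest component diameter, so
     [diam_merged] applies. *)
  have le_ecc : L./2 + 2 <= (ecc G u + ecc G v).+1.
    by case: stk => st; rewrite (ecc_stacked_floor st) //; lia.
  apply: (diam_merged Gamma_sym connect_Gamma cuv).
    by rewrite diam_Gamma; apply: leq_trans le_ecc.
  by rewrite diam_Gamma; apply: leq_trans le_ecc.
rewrite (bigD1 (component u)) /=; last by rewrite inE.
rewrite merged.
have := sum_component_diam.
rewrite (bigD1 (component v)) //= (bigD1 (component u)) //=.
set s := \sum_(_ | _) _; set s' := \sum_(_ | _) _.
have -> : s = s'.
  apply: eq_big => c; first by rewrite inE.
  case/andP=> cv cu.
  by rewrite (diam_other Gamma_sym connect_Gamma) ?diam_Gamma.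
(* Positivity makes the truncated [- 1] of [sum_component_diam] a genuine subtraction. *)
have : 0 < n.+1 * (L./2 + 2) by rewrite muln_gt0 addn2.
lia.
Qed.

End Volcano.

(** * The bounds as fractions in the number of stacked components and half the order *)

Section Arithmetic.
Variables (n k : nat) (hq Lq : rat).
Hypotheses (n_gt0 : (0 < n)%N) (LqE : Lq = 2 * k%:R + 1).
Hypothesis (hqE : hq = (2 * n%:R + 1) * (2 * k%:R + 1)).

Let n_neq0 : n%:R != 0 :> rat. Proof. by rewrite pnatr_eq0 -lt0n. Qed.

Let L_neq0 : 2 * k%:R + 1 != 0 :> rat.
Proof. by rewrite gt_eqF // ltr_wpDl // mulr_ge0. Qed.

Let subhL : hq - Lq = 2 * n%:R * (2 * k%:R + 1).
Proof. by rewrite hqE LqE; ring. Qed.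

(** Here [hq + Lq] is [2 * (n + 1) * Lq], [hq - Lq] is [2 * n * Lq] and [Lq + 3] is [2 * (k + 2)],
    so [Lq] cancels. *)
Lemma mean_upper_bound : (Lq + 3) * (hq + Lq) / (2 * (hq - Lq))
  = (n.+1 * (k + 2))%N%:R / n%:R.
Proof.
by rewrite subhL hqE LqE natrM natrD -addn1 natrD; field; apply/andP.
Qed.

Lemma mean_lower_bound : (hq * Lq + 3 * hq + 6 * Lq) / (2 * (hq - Lq))
  = ((2 * n + 1) * (k + 2) + 3)%N%:R / 2 / n%:R.
Proof.
by rewrite subhL hqE LqE !(natrM, natrD); field; apply/andP.
Qed.

Lemma mean_bounds (N : nat) :
  ((2 * n + 1) * (k + 2) + 3 <= 2 * N <= 2 * (n.+1 * (k + 2)))%N ->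
  (hq * Lq + 3 * hq + 6 * Lq) / (2 * (hq - Lq)) <= N%:R / n%:R
  /\ N%:R / n%:R <= (Lq + 3) * (hq + Lq) / (2 * (hq - Lq)).
Proof.
rewrite mean_upper_bound mean_lower_bound => /andP[lo hi].
rewrite !ler_pM2r ?invr_gt0 ?ltr0n // ler_nat ler_pdivrMr // -natrM ler_nat.
by split; lia.
Qed.

End Arithmetic.

(** The quotient of [h] by [L] is odd, so the halving in [num_stacked] is exact. *)
Lemma num_stackedE h L : odd h -> (L %| h)%N ->
  h = ((num_stacked h L).*2.+1 * L)%N.
Proof.
move=> h_odd L_dvd_h; rewrite -[LHS](divnK L_dvd_h); congr (_ * _)%N.
have : odd (h %/ L) by move: h_odd; rewrite -{1}(divnK L_dvd_h) oddM => /andP[].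
by rewrite /num_stacked; move: (h %/ L)%N => {h_odd L_dvd_h} q; lia.
Qed.

Theorem mainTheorem14
  (p h L : nat) (P : algC -> Prop)
  (p_prime : prime p)
  (p_mod : (p = 71 %[mod 120])%N \/ (p = 119 %[mod 120])%N)
  (h_class_number : is_class_number (ring_of_integers p) h)
  (h_odd : odd h)
  (P_prime : prime_ideal (ring_of_integers p) P)
  (P_above_2 : P 2%:R)
  (L_order : is_class_order (ring_of_integers p) P L)
  (L_odd : odd L) (L_ge3 : (3 <= L)%N) (L_dvd_h : (L %| h)%N)
  (u v : vertex h L)
  (u_floor : is_floor u) (v_floor : is_floor v) (uv_distinct : u != v)
  (attachment : ~~ connect (@Gamma h L) u v) :
  let S := add_edge (@Gamma h L) u v in
  let hq : rat := h%:R in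
  let Lq : rat := L%:R in
  (in_stacked u -> in_stacked v ->
     mean_diam S = ((Lq + 3) * (hq + Lq)) / (2 * (hq - Lq)))
  /\
  (in_folded u /\ in_stacked v \/ in_stacked u /\ in_folded v ->
     (hq * Lq + 3 * hq + 6 * Lq) / (2 * (hq - Lq)) <= mean_diam S
     /\ mean_diam S <= ((Lq + 3) * (hq + Lq)) / (2 * (hq - Lq))).
Proof.
move=> S hq Lq.
have cuv : component u != component v.
  by move: attachment; rewrite connect_Gamma.
have mdS := mean_diam_attachment L_odd L_ge3 u_floor v_floor cuv.
have L_eq : L = (L./2).*2.+1 by rewrite -[LHS]odd_double_half L_odd.
have h_eq := num_stackedE h_odd L_dvd_h.
have LqE : Lq = 2 * (L./2)%N%:R + 1 by rewrite /Lq {1}L_eq -addn1 -mul2n natrD natrM.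
have hqE : hq = (2 * (num_stacked h L)%:R + 1) * (2 * (L./2)%N%:R + 1).
  by rewrite /hq {1}h_eq natrM -/Lq LqE -addn1 -mul2n natrD natrM.
split=> [uS vS|].
  rewrite mdS; last by left.
  rewrite (mean_upper_bound (stacked_num_gt0 uS) LqE hqE).
  (* Both eccentricities equal the diameters of their components, so the correction terms cancel. *)
  by rewrite !component_diam_stacked ?ecc_stacked_floor // addnK.
case=> [[uF vS]|[uS vF]].
  rewrite mdS; last by right.
  apply: (mean_bounds (stacked_num_gt0 vS) LqE hqE).
  (* With [k = L./2] and [e] the eccentricity of [u], the numerator is
     [(n + 1) * (k + 2) + e - (k + 1)]; the bounds [k + 3 <= 2 * e] and [e <= k + 1] give the two
     ends. *)
  have := ecc_folded_floor L_odd L_ge3 uF u_floor.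
  rewrite component_diam_folded ?component_diam_stacked ?(ecc_stacked_floor _ _ vS) //.
  by move: (ecc _ u) (num_stacked h L) (L./2)%N; clear; lia.
rewrite mdS; last by left.
apply: (mean_bounds (stacked_num_gt0 uS) LqE hqE).
have := ecc_folded_floor L_odd L_ge3 vF v_floor.
rewrite component_diam_stacked ?component_diam_folded ?(ecc_stacked_floor _ _ uS) //.
by move: (ecc _ v) (num_stacked h L) (L./2)%N; clear; lia.
Qed.
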